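(* For each $\varepsilon>0$ and $v_0\ge0$ there exist constants $A,B>0$ such that for all $n\ge1$ and all $v\in[0,v_0]$, \[\mathbb P\big(T((0,0),(n,\lceil vn\rceil))\ge n(\Lambda(v)+\varepsilon)\big)\le A\exp(-Bn).\]
   Context: Model: Let $G$ be any probability measure on $[0,\infty)$. In $\mathbb Z^2$, every vertical edge has weight $1$ and every horizontal edge an independent random weight with law $G$; the passage time of a nearest-neighbour path is the sum of its edge weights; $T(u,w)$ is the infimum over paths from $u$ to $w$. For $v\ge0$, $\Lambda(v)=\lim_n\frac1nT((0,0),(n,\lceil vn\rceil))$ (a.s. limit, deterministic). *)

(* Defs.v *)
From HB Require Import structures.
From mathcomp Require Import all_boot all_order all_algebra.
From mathcomp Require Import all_classical all_reals all_analysis.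
Set Implicit Arguments. Unset Strict Implicit. Unset Printing Implicit Defensive.
Import Order.TTheory GRing.Theory Num.Theory.
Import numFieldNormedType.Exports.
Local Open Scope classical_set_scope.
Local Open Scope ring_scope.

Definition vertex := (int * int)%type.

Definition adjacent (a b : vertex) : bool :=
  ((a.1 == b.1) && (`|a.2 - b.2| == 1)) || ((a.2 == b.2) && (`|a.1 - b.1| == 1)).

(* Weight of the edge {a,b} (a, b adjacent): vertical edges weigh 1, the
   horizontal edge {(x,y),(x+1,y)} weighs w (x,y) (indexed by its left end). *)
Definition edge_weight {R : realType} (w : vertex -> R) (a b : vertex) : R :=
  if a.1 == b.1 then 1 else w (Order.min a.1 b.1, a.2).

Definition nn_path_from_to (u z : vertex) (s : seq vertex) : bool :=
  path adjacent u s && (last u s == z).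

Definition path_time {R : realType} (w : vertex -> R) (u : vertex) (s : seq vertex) : R :=
  \sum_(e <- zip (u :: s) s) edge_weight w e.1 e.2.

Definition passage_time {R : realType} (w : vertex -> R) (u z : vertex) : R :=
  inf [set t | exists s, nn_path_from_to u z s /\ t = path_time w u s].

Definition mutually_independent {d} {T : measurableType d} {R : realType}
  (P : probability T R) (I : eqType) (X : I -> T -> R) : Prop :=
  forall (J : seq I) (A : I -> set R), uniq J ->
    (forall j, j \in J -> measurable (A j)) ->
    P [set x | forall j, j \in J -> A j (X j x)] =
    (\big[*%E/1%E]_(j <- J) P (X j @^-1` A j))%E.

(* Main.v *)
Require Import Defs.
From HB Require Import structures.
From mathcomp Require Import all_boot all_order all_algebra.
From mathcomp Require Import all_classical all_reals all_analysis.
From mathcomp Require Import measurable_realfun zify lra.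
Set Implicit Arguments. Unset Strict Implicit. Unset Printing Implicit Defensive.
Import Order.TTheory GRing.Theory Num.Theory.
Import numFieldNormedType.Exports.
Local Open Scope classical_set_scope.
Local Open Scope ring_scope.

(* Concatenating blocks of a large size [M] along direction [v] bounds the
   passage time.  Since [T(0, (M, vM)) / M] tends to [Lambda v], a block is
   traversed by one of finitely many fixed paths in time
   [M * (Lambda v + eps / 8)] with probability close to 1; each such event
   depends on finitely many edges, so blocks whose indices agree modulo a large
   [Q] are independent, and a union bound shows that, off an exponentially small
   event, only a small fraction of the blocks is bad.  A bad block is crossed
   along its bottom row: in each column one climbs to an edge of weight at most
   [L] and comes back.  When [P(weight > L)] is small enough, the total climb
   over all [n] columns is small compared with [n], again off an exponentially
   small event.  Uniformity in [v] follows from a finite grid, because both the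
   passage time and [Lambda] are Lipschitz in the direction (vertical edges
   weigh 1). *)

(** * Paths, concatenation and passage times *)

Section paths.
Context {R : realType}.
Implicit Types (w : vertex -> R) (u z : vertex) (s : seq vertex).

(** Such bounds add up under concatenation for arbitrary real weights; signs enter only when they
    are turned into bounds on the infimum [passage_time]. *)
Definition reach w u z (t : R) : Prop :=
  exists s, nn_path_from_to u z s /\ path_time w u s <= t.

Lemma path_time_nil w u : path_time w u [::] = 0.
Proof. by rewrite /path_time /= big_nil. Qed.

Lemma path_time_cons w u x s :
  path_time w u (x :: s) = edge_weight w u x + path_time w x s.
Proof. by rewrite /path_time /= big_cons. Qed.

Lemma path_time_cat w u s1 s2 :
  path_time w u (s1 ++ s2) = path_time w u s1 + path_time w (last u s1) s2.
Proof.
elim: s1 u => [|x s1 IH] u /=; first by rewrite path_time_nil add0r.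
by rewrite !path_time_cons IH addrA.
Qed.

Lemma path_time_ge0 w u s : (forall e, 0 <= w e) -> 0 <= path_time w u s.
Proof.
by move=> w0; apply: sumr_ge0 => e _; rewrite /edge_weight; case: ifP.
Qed.

Lemma reach_refl w u : reach w u u 0.
Proof. by exists [::]; rewrite path_time_nil /nn_path_from_to /= eqxx. Qed.

Lemma reach_le w u z t t' : t <= t' -> reach w u z t -> reach w u z t'.
Proof. by move=> tt' [s [ps st]]; exists s; split=> //; exact: le_trans tt'. Qed.

Lemma reach_trans w y u z t t' :
  reach w u y t -> reach w y z t' -> reach w u z (t + t').
Proof.
move=> [s [/andP[ps /eqP us] st]] [s' [/andP[ps' ys'] st']]; exists (s ++ s').
by rewrite /nn_path_from_to cat_path last_cat us ps ps' ys' path_time_cat us lerD.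
Qed.

Lemma reach_edge w u z : Defs.adjacent u z -> reach w u z (edge_weight w u z).
Proof.
move=> auz; exists [:: z]; rewrite /nn_path_from_to /= auz eqxx.
by rewrite path_time_cons path_time_nil addr0.
Qed.

Lemma reach_up w (x y : int) (k : nat) : reach w (x, y) (x, y + k%:Z) k%:R.
Proof.
elim: k => [|k IH]; first by rewrite addr0; exact: reach_refl.
have -> : y + k.+1%:Z = y + k%:Z + 1 by lia.
rewrite -natr1; apply: reach_trans IH _.
have := @reach_edge w (x, y + k%:Z) (x, y + k%:Z + 1).
by rewrite /edge_weight /= eqxx; apply; rewrite /Defs.adjacent /= eqxx /=; lia.
Qed.

Lemma reach_down w (x y : int) (k : nat) : reach w (x, y + k%:Z) (x, y) k%:R.
Proof.
elim: k => [|k IH]; first by rewrite addr0; exact: reach_refl.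
have -> : y + k.+1%:Z = y + k%:Z + 1 by lia.
rewrite -nat1r; apply: reach_trans _ IH.
have := @reach_edge w (x, y + k%:Z + 1) (x, y + k%:Z).
by rewrite /edge_weight /= eqxx; apply; rewrite /Defs.adjacent /= eqxx /=; lia.
Qed.

Lemma reach_vertical w (x y y' : int) : reach w (x, y) (x, y') `|y' - y|%:~R.
Proof.
have [yy'|/ltW y'y] := leP y y'.
  have := reach_up w x y `|y' - y|%N.
  rewrite gez0_abs ?subr_ge0// (_ : y + (y' - y) = y') => [|]; last by lia.
  by rewrite natr_absz.
have := reach_down w x y' `|y' - y|%N.
rewrite (_ : y' + `|y' - y|%N = y) ?natr_absz//; by lia.
Qed.

Lemma reach_right w (x y : int) : reach w (x, y) (x + 1, y) (w (x, y)).
Proof.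
have := @reach_edge w (x, y) (x + 1, y).
rewrite /edge_weight /= (_ : (x == x + 1) = false) ?(min_l (_ : x <= x + 1)); try lia.
by apply; rewrite /Defs.adjacent /= eqxx /=; lia.
Qed.

(* Climb [i] steps to a light edge, cross it, and come back down. *)
Lemma reach_column w (x y : int) (i : nat) (L : R) :
  w (x, y + i%:Z) <= L -> reach w (x, y) (x + 1, y) (L + (i%:R + i%:R)).
Proof.
move=> wL; apply: (reach_le (_ : i%:R + w (x, y + i%:Z) + i%:R <= _)); first by lra.
apply: reach_trans (reach_down w (x + 1) y i).
by apply: reach_trans (reach_up w x y i) _; exact: reach_right.
Qed.

Lemma reach_row w (y : int) (x0 m : nat) (i : nat -> nat) (L : R) :
  (forall j, (j < m)%N -> w ((x0 + j)%:Z, y + (i (x0 + j)%N)%:Z) <= L) ->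
  reach w (x0%:Z, y) ((x0 + m)%:Z, y)
    (L * m%:R + 2 * (\sum_(x0 <= x < x0 + m) i x)%N%:R).
Proof.
elim: m => [|m IH] wL.
  by rewrite addn0 big_geq// !mulr0 addr0; exact: reach_refl.
rewrite addnS big_nat_recr ?leq_addr//= natrD.
apply: (reach_le (_ : (L * m%:R + 2 * (\sum_(x0 <= x < x0 + m) i x)%N%:R) +
  (L + ((i (x0 + m)%N)%:R + (i (x0 + m)%N)%:R)) <= _)).
  by rewrite -natr1; lra.
apply: reach_trans (IH _) _; first by move=> j jm; apply: wL; lia.
have := @reach_column w (x0 + m)%N%:Z y _ L (wL m (ltnSn m)).
by have -> : (x0 + m)%:Z + 1 = (x0 + m).+1%:Z by lia.
Qed.

(** Carries a crossing found in the environment seen from [c] to the block that starts at [c]. *)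
Lemma reach_shift w (c u z : vertex) t :
  reach (fun e => w (e + c)) u z t -> reach w (u + c) (z + c) t.
Proof.
move=> [s [/andP[ps /eqP us] st]]; exists (map (fun e => e + c) s).
rewrite /nn_path_from_to (last_map (fun e => e + c)) us eqxx andbT; split.
  elim: s u ps {us st} => //= x s IH u /andP[ux xs]; rewrite IH// andbT.
  move: ux; rewrite /Defs.adjacent /= !(inj_eq (addIr _)).
  by rewrite !(opprD, addrACA _ _ (- _)) !subrr !addr0.
suff -> : path_time w (u + c) (map (fun e => e + c) s) =
    path_time (fun e => w (e + c)) u s by [].
elim: s u {ps us st} => [|x s IH] u; first by rewrite !path_time_nil.
rewrite /= !path_time_cons IH; congr (_ + _).
rewrite /edge_weight /= (inj_eq (addIr _)); case: ifP => // _.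
by congr w; rewrite /= -addr_minl.
Qed.

(* Diagonal concatenation of [K] blocks of size [(M, h)], followed by a row of
   length [r]; a bad block is crossed along its bottom row and then climbed. *)
Lemma reach_blocks w (M K r : nat) (h : nat) (y : nat -> int) (i : nat -> nat)
    (bad : pred nat) (g L : R) :
  0 <= g -> 0 <= L ->
  (forall k j, (k < K)%N -> (j < M)%N -> y (k * M + j)%N = (k * h)%N%:Z) ->
  (forall j, (j < r)%N -> y (K * M + j)%N = (K * h)%N%:Z) ->
  (forall x, (x < K * M + r)%N -> w (x%:Z, y x + (i x)%:Z) <= L) ->
  (forall k, (k < K)%N -> ~~ bad k ->
     reach w ((k * M)%N%:Z, (k * h)%N%:Z) ((k.+1 * M)%N%:Z, (k.+1 * h)%N%:Z) g) ->
  reach w (0, 0) ((K * M + r)%N%:Z, (K * h)%N%:Z)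
    (K%:R * g + (\sum_(k < K) bad k)%N%:R * (L * M%:R + h%:R) +
     2 * (\sum_(0 <= x < K * M + r) i x)%N%:R + L * r%:R).
Proof.
move=> g0 L0 yB yr wL good.
have wrow k m : (forall j, (j < m)%N -> y (k * M + j)%N = (k * h)%N%:Z) ->
    (k * M + m <= K * M + r)%N ->
    reach w ((k * M)%N%:Z, (k * h)%N%:Z) ((k * M + m)%N%:Z, (k * h)%N%:Z)
    (L * m%:R + 2 * (\sum_(k * M <= x < k * M + m) i x)%N%:R).
  move=> yk km; apply: reach_row => j jm; rewrite -(yk _ jm).
  by apply: wL; apply: leq_trans km; rewrite ltn_add2l.
have step k : (k <= K)%N -> reach w (0, 0) ((k * M)%N%:Z, (k * h)%N%:Z)
    (k%:R * g + (\sum_(j < k) bad j)%N%:R * (L * M%:R + h%:R) +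
     2 * (\sum_(0 <= x < k * M) i x)%N%:R).
  elim: k => [_|k IH kK].
    by rewrite big_ord0 big_geq// !mul0r mulr0 !addr0; exact: reach_refl.
  have IHk := IH (ltnW kK).
  have sM : (k.+1 * M = k * M + M)%N by rewrite mulSn addnC.
  have sh : (k.+1 * h = k * h + h)%N by rewrite mulSn addnC.
  have kMK : (k.+1 * M <= K * M)%N by rewrite leq_mul2r kK orbT.
  have kMr : (k * M + M <= K * M + r)%N by rewrite -sM (leq_trans kMK)// leq_addr.
  rewrite big_ord_recr /= natrD (big_cat_nat (n := (k * M)%N)) //=; last by lia.
  rewrite natrD.
  set S := (\sum_(j < k) bad j)%N; set I1 := (\sum_(0 <= x < k * M) i x)%N.
  set I2 := (\sum_(k * M <= x < k.+1 * M) i x)%N.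
  case bk : (bad k) => /=; last first.
    apply: (reach_le _ (reach_trans IHk (good k kK (negbT bk)))).
    have := ler0n R I2; rewrite -natr1 -/S -/I1; lra.
  (* A bad block costs [L * M] for its edges, twice its climbs, and [h] vertical steps to regain the
     diagonal. *)
  have row := wrow k M (fun j => yB k j kK) kMr.
  have vert := reach_up w (k * M + M)%N%:Z (k * h)%N%:Z h.
  rewrite -PoszD -sh -sM in vert; rewrite -sM in row.
  apply: (reach_le _ (reach_trans (reach_trans IHk row) vert)).
  rewrite -natr1 -/S -/I1 -/I2; lra.
have row := wrow K r yr (leqnn _).
apply: (reach_le _ (reach_trans (step K (leqnn K)) row)).
rewrite (big_cat_nat (n := (K * M)%N) (m := 0%N) (p := (K * M + r)%N))//= ?leq_addr// natrD; lra.
Qed.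

Lemma passage_time_le w u z t :
  (forall e, 0 <= w e) -> reach w u z t -> passage_time w u z <= t.
Proof.
move=> w0 [s [us st]]; apply: le_trans st; apply: ge_inf; last by exists s.
by exists 0 => _ [s' [_ ->]]; exact: path_time_ge0.
Qed.

(** Ensures that the infimum defining [passage_time] is over a nonempty set. *)
Lemma path_exists w (n : nat) (y : int) :
  exists s, nn_path_from_to (0, 0) (n%:Z, y) s.
Proof.
have wS (j : nat) : (j < n)%N -> w ((0 + j)%N%:Z, 0 + 0%N%:Z) <= \sum_(k < n) `|w (k%:Z, 0)|.
  move=> jn; rewrite add0n add0r; apply: le_trans (ler_norm _) _.
  by rewrite (bigD1 (Ordinal jn))//= lerDl sumr_ge0.
have [s [ps _]] := reach_trans (@reach_row w 0 0 n (fun=> 0%N) _ wS)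
  (reach_vertical w n%:Z 0 y).
by exists s.
Qed.

(** Holds for weights of any sign: if the path times are unbounded below, [inf] has its default
    value, but then some path beats every [t]. *)
Lemma passage_time_lt w (n : nat) (y : int) t :
  passage_time w (0, 0) (n%:Z, y) < t ->
  exists s, nn_path_from_to (0, 0) (n%:Z, y) s /\ path_time w (0, 0) s < t.
Proof.
rewrite /passage_time; set S := (X in inf X) => St.
have [lbS|nlbS] := pselect (has_lbound S); last first.
  apply: contrapT => nex; apply: nlbS; exists t => _ [s [ps ->]].
  by rewrite leNgt; apply/negP => st; apply: nex; exists s.
have infS : has_inf S.
  by split=> //; have [s ps] := path_exists w n y; exists (path_time w (0, 0) s), s.
have [_ [s [ps ->]] st] := inf_adherent (ltac:(by rewrite subr_gt0) : 0 < t - inf S) infS.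
by exists s; split=> //; rewrite addrC subrK in st.
Qed.

(** Append a vertical segment to a nearly optimal path; its edges weigh 1. *)
Lemma passage_time_vertical w (n : nat) (y y' : int) :
  (forall e, 0 <= w e) ->
  passage_time w (0, 0) (n%:Z, y') <=
  passage_time w (0, 0) (n%:Z, y) + `|y' - y|%:~R.
Proof.
move=> w0; rewrite leNgt; apply/negP; rewrite -ltrBrDr => /passage_time_lt[s [ps st]].
suff : passage_time w (0, 0) (n%:Z, y') <= path_time w (0, 0) s + `|y' - y|%:~R by lra.
by apply: passage_time_le => //; apply: reach_trans (reach_vertical _ _ _ _); exists s.
Qed.

End paths.

(** * Finite intersections of events *)

Section forall_in.
Context {I : eqType}.

Lemma forall_in_cons (T : Type) (x : I) (s : seq I) (A : I -> set T) :
  [set t | forall i, i \in x :: s -> A i t] =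
  A x `&` [set t | forall i, i \in s -> A i t].
Proof.
apply/seteqP; split=> t /=.
  by move=> At; split=> [|i si]; apply: At; rewrite inE ?eqxx// si orbT.
by move=> [Ax As] i; rewrite inE => /predU1P[->|/As].
Qed.

Lemma measurable_forall_in d (T : measurableType d) (s : seq I) (A : I -> set T) :
  (forall i, i \in s -> measurable (A i)) ->
  measurable [set t | forall i, i \in s -> A i t].
Proof.
elim: s => [|x s IH] mA.
  by rewrite (_ : [set _ | _] = setT)//; apply/seteqP; split.
rewrite forall_in_cons; apply: measurableI; first exact/mA/mem_head.
by apply: IH => i si; apply: mA; rewrite inE si orbT.
Qed.

End forall_in.

(** * Cylinder events over finitely many edges *)

Section cylinders.
Context {R : realType}.

Definition rect (J : seq vertex) (A : vertex -> set R) : set (vertex -> R) :=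
  [set w | forall j, j \in J -> A j (w j)].

(** A pi-system; [<<s rects J >>] plays the role of the events determined by the edges in [J]. *)
Definition rects (J : seq vertex) : set (set (vertex -> R)) :=
  [set rect J A | A in [set A | forall j, measurable (A j)]].

Lemma rects_setI_closed J : setI_closed (rects J).
Proof.
move=> _ _ [A mA <-] [B mB <-]; exists (fun j => A j `&` B j).
  by move=> j; exact: measurableI.
apply/seteqP; split=> w /=; first by move=> AB; split=> j /AB[].
by move=> [wA wB] j jJ; split; [exact: wA|exact: wB].
Qed.

Lemma rectT J : rect J (fun=> setT) = setT.
Proof. by apply/seteqP; split. Qed.

Context {d} {Omega : measurableType d}.
Variable V : Omega -> vertex -> R.
Hypothesis mV : forall e, measurable_fun setT (fun om => V om e).

Lemma measurable_rect J A : (forall j, measurable (A j)) ->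
  measurable (V @^-1` rect J A).
Proof.
move=> mA; apply: measurable_forall_in => j _.
by rewrite -[X in measurable X]setTI; exact: mV.
Qed.

Lemma measurable_cyl J F : <<s rects J >> F -> measurable (V @^-1` F).
Proof.
pose H := [set F | measurable (V @^-1` F)].
suff : <<s rects J >> `<=` H by exact.
apply: smallest_sub; last by move=> _ [A mA <-]; exact: measurable_rect.
split; rewrite /H /=.
- by rewrite preimage_set0.
- by move=> A mA; rewrite setTD preimage_setC; exact: measurableC.
- by move=> A mA; rewrite preimage_bigcup; exact: bigcupT_measurable.
Qed.

End cylinders.

(** * Independence and translation invariance *)

Section independence.
Context {R : realType} {d} {Omega : measurableType d}.
Variables (P : probability Omega R) (G : probability R R) (W : Omega -> vertex -> R).
Hypothesis mW : forall e : vertex, measurable_fun setT (fun om => W om e).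
Hypothesis lawW : forall (e : vertex) (A : set R), measurable A ->
  P ((fun om => W om e) @^-1` A) = G A.
Hypothesis indW : mutually_independent P (fun (e : vertex) om => W om e).

(** The sets [F] satisfying the identity form a lambda-system. With [V] on the left and [W] on the
    right, it expresses independence from [E] and replaces the law of [V] by that of [W] at once. *)
Lemma indep_cyl_of_rect (V : Omega -> vertex -> R) J (E : set Omega) :
  (forall e, measurable_fun setT (fun om => V om e)) -> measurable E ->
  (forall A, (forall j, measurable (A j)) ->
     P (E `&` V @^-1` rect J A) = (P E * P (W @^-1` rect J A))%E) ->
  forall F, <<s rects J >> F -> P (E `&` V @^-1` F) = (P E * P (W @^-1` F))%E.
Proof.
move=> mV mE EA.
pose H := [set F | [/\ measurable (V @^-1` F), measurable (W @^-1` F) &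
  P (E `&` V @^-1` F) = (P E * P (W @^-1` F))%E]].
suff sH : <<s rects J >> `<=` H by move=> F /sH[].
apply: lambda_system_subset => //; first exact: rects_setI_closed.
  apply/dynkin_lambda_system; split; rewrite /H /=.
  - by rewrite !preimage_setT setIT probability_setT mule1.
  - move=> A [mVA mWA EVA]; split; [exact: (measurableC mVA)|exact: (measurableC mWA)|].
    rewrite -[V @^-1` _]/(~` (V @^-1` A)) -[W @^-1` _]/(~` (W @^-1` A)).
    rewrite probability_setC// muleBr// ?mule1; last first.
      exact: fin_num_measure.
    rewrite -EVA -setDE measureD// ltey_eq fin_num_measure//.
  - move=> A tA HA; rewrite /= !preimage_bigcup.
    have tp (V' : Omega -> vertex -> R) : trivIset setT (fun k => V' @^-1` A k).
      by move=> i j _ _ [om [Ai Aj]]; apply: tA => //; exists (V' om).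
    split.
    + by apply: bigcupT_measurable => k; have [] := HA k.
    + by apply: bigcupT_measurable => k; have [] := HA k.
    rewrite setI_bigcupr !measure_bigcup//.
    + rewrite -[P E in RHS]fineK ?fin_num_measure// -nneseriesZl//.
      by apply: eq_eseriesr => k _; rewrite fineK ?fin_num_measure//; have [] := HA k.
    + by move=> k _; have [] := HA k.
    + by move=> k _; apply: measurableI => //; have [] := HA k.
    + by apply: trivIset_setIl; exact: tp.
move=> _ [A mA <-]; split; last exact: EA; exact: measurable_rect.
Qed.

Definition translate (c : vertex) (om : Omega) : vertex -> R := fun e => W om (e + c).

Lemma measurable_translate c e : measurable_fun setT (fun om => translate c om e).
Proof. exact: mW. Qed.

Lemma prob_rect J A : uniq J -> (forall j, measurable (A j)) ->
  P (W @^-1` rect J A) = (\big[*%E/1%E]_(j <- J) G (A j))%E.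
Proof.
move=> uJ mA; have /= := indW uJ (fun j _ => mA j); rewrite /rect => ->.
by apply: eq_bigr => j _; exact: lawW.
Qed.

(** The two constraints concern disjoint sets of edges, so they merge into one rectangle; as all
    weights have law [G], its probability factors and the shift disappears. *)
Lemma prob_rect_translate c J A J' B : uniq J -> uniq J' ->
  (forall j, measurable (A j)) -> (forall j, measurable (B j)) ->
  (forall j, j \in J -> j + c \notin J') ->
  exists2 D, (forall j, measurable (D j)) &
  W @^-1` rect J' B `&` translate c @^-1` rect J A =
    W @^-1` rect (J' ++ [seq j + c | j <- J]) D /\
  P (W @^-1` rect (J' ++ [seq j + c | j <- J]) D) =
    (P (W @^-1` rect J' B) * P (W @^-1` rect J A))%E.
Proof.
move=> uJ uJ' mA mB JJ'.
pose D e := if e \in J' then B e else A (e - c).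
have mD j : measurable (D j) by rewrite /D; case: ifP.
exists D => //; split.
  apply/seteqP; split=> om /=.
    move=> [WB WA] j; rewrite mem_cat => /orP[jJ'|].
      by rewrite /D jJ'; exact: WB.
    move=> /mapP[i iJ ->]; rewrite /D (negbTE (JJ' _ iJ)) addrK.
    exact: WA.
  move=> WD; split=> j jJ.
    by have := WD j; rewrite mem_cat jJ /D jJ; exact.
  have := WD (j + c); rewrite mem_cat (map_f (fun j => j + c)) ?orbT// /D (negbTE (JJ' _ jJ)) addrK.
  exact.
rewrite !prob_rect//; last first.
  rewrite cat_uniq uJ' map_inj_uniq ?uJ ?andbT//=; last exact: addIr.
  by apply/hasPn => _ /mapP[j jJ ->]; exact: JJ'.
rewrite big_cat big_map /=; congr (_ * _)%E.
  by apply: eq_big_seq => j jJ'; rewrite /D jJ'.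
by apply: eq_big_seq => j jJ; rewrite /D (negbTE (JJ' _ jJ)) addrK.
Qed.

(* The extra rectangle makes the induction on [cs] work: a single pi-lambda
   argument per step yields translation invariance and independence at once. *)
Lemma prob_translates J F (cs : seq vertex) J' B :
  <<s rects J >> F -> uniq J -> uniq cs ->
  (forall c c' j j', c \in cs -> c' \in cs -> j \in J -> j' \in J ->
     j + c = j' + c' -> c = c') ->
  uniq J' -> (forall j, measurable (B j)) ->
  (forall c j, c \in cs -> j \in J -> j + c \notin J') ->
  P (W @^-1` rect J' B `&` [set om | forall c, c \in cs -> F (translate c om)]) =
  (P (W @^-1` rect J' B) * P (W @^-1` F) ^+ size cs)%E.
Proof.
move=> sF uJ; elim: cs J' B => [|c cs IH] J' B.
  by move=> _ _ _ _ _; rewrite mule1 (_ : [set _ | _] = setT) ?setIT//; apply/seteqP; split.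
rewrite cons_uniq => /andP[ccs ucs] inj uJ' mB JJ'.
have mcs : measurable [set om | forall c, c \in cs -> F (translate c om)].
  apply: measurable_forall_in => c' _.
  exact: (measurable_cyl (measurable_translate c') sF).
have injcs : (forall c c' j j', c \in cs -> c' \in cs -> j \in J -> j' \in J ->
     j + c = j' + c' -> c = c').
  by move=> c1 c2 j1 j2 c1cs c2cs; apply: inj; rewrite inE ?c1cs ?c2cs orbT.
have JJ'cs c' j : c' \in cs -> j \in J -> j + c' \notin J'.
  by move=> c'cs; apply: JJ'; rewrite inE c'cs orbT.
set E := W @^-1` rect J' B `&` [set om | forall c, c \in cs -> F (translate c om)].
have PE : P E = (P (W @^-1` rect J' B) * P (W @^-1` F) ^+ size cs)%E by exact: IH.
have mE : measurable E by apply: measurableI => //; exact: measurable_rect.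
rewrite (forall_in_cons c cs (fun c => translate c @^-1` F)) setIA setIAC -/E.
rewrite (indep_cyl_of_rect (measurable_translate c) mE _ sF).
  by rewrite PE [in RHS]expeS -muleA (muleC (_ ^+ _)).
move=> A mA.
(* The constraint at [c] is absorbed into the extra rectangle, to which the induction hypothesis
   then applies. *)
have [D mD [DE PD]] := @prob_rect_translate c J A J' B uJ uJ' mA mB
  (fun j jJ => JJ' c j (mem_head _ _) jJ).
rewrite /E setIAC DE IH//.
- by rewrite PD PE muleAC.
- rewrite cat_uniq uJ' map_inj_uniq ?uJ ?andbT//=; last exact: addIr.
  by apply/hasPn => _ /mapP[j jJ ->]; apply: JJ' => //; exact: mem_head.
- move=> c' j c'cs jJ; rewrite mem_cat negb_or JJ'cs//=.
  apply/negP => /mapP[i iJ jc]; move/negP: ccs; apply.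
  by rewrite (inj c c' i j)// ?mem_head// inE c'cs orbT.
Qed.

End independence.

(** * Exponential union bounds *)

Section union_bounds.
Context {R : realType}.

Lemma probability_setU_le d (Omega : measurableType d) (P : probability Omega R)
    (A B : set Omega) (x y : \bar R) : measurable A -> measurable B ->
  (P A <= x)%E -> (P B <= y)%E -> (P (A `|` B) <= x + y)%E.
Proof. by move=> mA mB Ax By; apply: (le_trans (measureU2 _ mA mB)); exact: leeD. Qed.

Lemma probability_bigsetU_le d (Omega : measurableType d) (P : probability Omega R)
    (I : Type) (r : seq I) (Q : pred I) (F : I -> set Omega) :
  (forall i, measurable (F i)) ->
  (P (\big[setU/set0]_(i <- r | Q i) F i) <= \sum_(i <- r | Q i) P (F i))%E.
Proof.
move=> mF; elim: r => [|i r IH]; first by rewrite !big_nil measure0.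
rewrite !big_cons; case: ifP => // _; apply: probability_setU_le => //.
by apply: bigsetU_measurable => j _; exact: mF.
Qed.

Lemma sum_expr_le2 (q : R) m : 0 <= q <= 2^-1 -> \sum_(j < m) q ^+ j <= 2.
Proof.
move=> /andP[q0 q2]; elim: m => [|m IH]; first by rewrite big_ord0.
rewrite big_ord_recl expr0 /=.
under eq_bigr do rewrite /bump /= add1n exprS.
rewrite -mulr_sumr.
have s0 : 0 <= \sum_(j < m) q ^+ j by apply: sumr_ge0 => j _; exact: exprn_ge0.
by nra.
Qed.

(** The factor [2 ^+ n] is the entropy of a union bound; as [a * (n %/ a).+1] exceeds [n], the other
    factor is at most [4^-1 ^+ n]. *)
Lemma two_quarter_pow (a n : nat) : (0 < a)%N ->
  2 ^+ n * ((4^-1 : R) ^+ a) ^+ (n %/ a).+1 <= 2^-1 ^+ n.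
Proof.
move=> a0; rewrite -exprM; apply: (@le_trans _ _ (2 ^+ n * 4^-1 ^+ n)).
  apply: ler_wpM2l; first exact: exprn_ge0.
  by apply: ler_wiXn2l; rewrite ?invr_ge0 ?invf_le1 ?ler1n// ltnW// mulnC ltn_ceil.
by rewrite -exprMn (_ : 2 * 4^-1 = 2^-1)//; lra.
Qed.

Context {d} {Omega : measurableType d}.
Variables (P : probability Omega R) (G : probability R R) (W : Omega -> vertex -> R).
Hypothesis mW : forall e : vertex, measurable_fun setT (fun om => W om e).
Hypothesis lawW : forall (e : vertex) (A : set R), measurable A ->
  P ((fun om => W om e) @^-1` A) = G A.
Hypothesis indW : mutually_independent P (fun (e : vertex) om => W om e).

(** The edges that must all be heavy to force a climb of [f x] from height [y x] in each column
    [x]. *)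
Definition above n (y : nat -> int) (f : 'I_n -> nat) : seq vertex :=
  [seq ((nat_of_ord x)%:Z, y x + j%:Z) | x <- enum 'I_n, j <- iota 0 (f x)].

Lemma size_above n y (f : 'I_n -> nat) : size (above y f) = (\sum_(x < n) f x)%N.
Proof.
rewrite size_allpairs_dep sumnE big_map big_enum /=.
by apply: eq_bigr => x _; rewrite size_iota.
Qed.

Lemma uniq_above n y (f : 'I_n -> nat) : uniq (above y f).
Proof.
apply: allpairs_uniq_dep; first exact: enum_uniq.
  by move=> x _; exact: iota_uniq.
move=> [x j] [x' j'] _ _ /= [xx' jj'].
have {}xx' : x = x' by apply/val_inj.
by rewrite -xx' in jj' *; congr existT; lia.
Qed.

(* The union bound runs over the climbs [f] of total height above [n / a] such
   that, in each column [x], all edges below height [f x] are heavy. *)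
Lemma light_columns (n a : nat) (y : nat -> int) (L : R) : (0 < a)%N ->
  (G [set x : R | (L < x)%R] <= ((4^-1 ^+ a) ^+ 2)%:E)%E ->
  exists U : set Omega, [/\ measurable U, (P U <= (2^-1 ^+ n)%:E)%E &
    forall om, ~ U om -> exists i : nat -> nat,
      (\sum_(0 <= x < n) i x <= n %/ a)%N /\
      forall x, (x < n)%N -> W om (x%:Z, y x + (i x)%:Z) <= L].
Proof.
move=> a0 GL; set q := 4^-1 ^+ a in GL; set S := (n %/ a)%N.
have q0 : 0 <= q by rewrite exprn_ge0// invr_ge0.
have q2 : q <= 2^-1.
  rewrite /q; case: a a0 {GL q q0 S} => // a _.
  have h : (4^-1 : R) ^+ a.+1 <= 4^-1 ^+ 1.
    by apply: ler_wiXn2l => //; rewrite ?invr_ge0 ?invf_le1 ?ler1n.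
  by apply: (le_trans h); rewrite expr1; lra.
have mL : measurable [set x : R | L < x].
  by rewrite (_ : [set _ | _] = `]L, +oo[%classic)//; apply/seteqP; split=> x /=;
    rewrite in_itv/= andbT.
pose E (f : {ffun 'I_n -> 'I_S.+2}) :=
  W @^-1` rect (above y (fun x => f x)) (fun=> [set x : R | L < x]).
have mE f : measurable (E f) by exact: measurable_rect.
exists (\big[setU/set0]_(f : {ffun 'I_n -> 'I_S.+2} | (S < \sum_(x < n) f x)%N) E f).
split.
- by apply: bigsetU_measurable => f _; exact: mE.
- apply: (le_trans (probability_bigsetU_le _ _ _ mE)).
  (* Each edge contributes [q ^+ 2]. As the total of [f] exceeds [S], one factor [q] per edge yields
     [q ^+ S.+1]; the other keeps the sum over all [f] bounded, since it splits into [n] geometric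
     sums. *)
  apply: (@le_trans _ _ (\sum_(f : {ffun 'I_n -> 'I_S.+2})
      (q ^+ S.+1 * \prod_(x < n) q ^+ f x)%:E)%E); last first.
    rewrite sumEFin lee_fin -mulr_sumr -(bigA_distr_bigA (fun _ (j : 'I_S.+2) => q ^+ j)).
    apply: le_trans (two_quarter_pow n a0); rewrite mulrC ler_wpM2r ?exprn_ge0//.
    rewrite prodr_const card_ord lerXn2r ?nnegrE ?sum_expr_le2 ?q0//.
    by apply: sumr_ge0 => j _; exact: exprn_ge0.
  rewrite big_mkcond /=; apply: lee_sum => f _; case: ifPn => [Sf|_]; last first.
    by rewrite lee_fin mulr_ge0 ?exprn_ge0// prodr_ge0// => x _; exact: exprn_ge0.
  rewrite /E (prob_rect lawW indW) ?uniq_above//.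
  apply: (@le_trans _ _ (((q ^+ 2) ^+ size (above y (fun x => f x)))%:E)).
    set p := q ^+ 2 in GL *.
    elim: (above y (fun x => f x)) => [|j s IH]; first by rewrite big_nil.
    by rewrite big_cons (exprS p (size s)) EFinM lee_pmul// prode_ge0.
  rewrite size_above lee_fin -exprM mul2n -addnn exprD prodrXr.
  apply: ler_wpM2r; first exact: exprn_ge0.
  by apply: ler_wiXn2l => //; lra.
move=> om nU.
(* First light edge of the column, or [S.+1] if the search fails. A failure alone would push the
   total above [S], so outside the union every search succeeds. *)
pose N x := find (fun j : nat => W om (x%:Z, y x + j%:Z) <= L) (iota 0 S.+1).
have NS x : (N x < S.+2)%N by rewrite ltnS -[S.+1](size_iota 0) find_size.
exists N; have NSum : (\sum_(0 <= x < n) N x <= S)%N.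
  rewrite leqNgt; apply/negP => SN; apply: nU.
  rewrite -bigcup_seq_cond; exists [ffun x : 'I_n => inord (N x)].
    rewrite /= mem_index_enum /=; apply: leq_trans SN _; rewrite big_mkord.
    by apply: leq_sum => x _; rewrite ffunE inordK.
  move=> e /allpairsPdep[x [j [_]]]; rewrite mem_iota add0n ffunE inordK// => jN ->.
  have := before_find 0%N jN; rewrite nth_iota ?add0n; last by rewrite -ltnS (leq_ltn_trans jN).
  by move=> /negbT; rewrite -ltNge.
split=> // x xn.
have NxS : (N x <= S)%N.
  apply: leq_trans NSum; rewrite big_mkord.
  by rewrite (bigD1 (Ordinal xn))//= leq_addr.
have /(nth_find 0%N) : has (fun j : nat => W om (x%:Z, y x + j%:Z) <= L) (iota 0 S.+1).
  by rewrite has_find size_iota ltnS.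
by rewrite nth_iota// add0n.
Qed.

(** Union bound over the at most [2 ^+ K] sets of more than [K %/ b] indices; for each set the
    translated events are independent because their edges are disjoint. *)
Lemma few_bad_translates (J : seq vertex) (F : set (vertex -> R)) (c : nat -> vertex)
    (K b : nat) : (0 < b)%N ->
  uniq J -> <<s rects J >> F -> injective c ->
  (forall k k' j j', j \in J -> j' \in J -> j + c k = j' + c k' -> k = k') ->
  (P (W @^-1` F) <= (4^-1 ^+ b)%:E)%E ->
  exists U : set Omega, [/\ measurable U, (P U <= (2^-1 ^+ K)%:E)%E &
    forall om, ~ U om ->
      (\sum_(k < K) `[< F (translate W (c k) om) >] <= K %/ b)%N].
Proof.
move=> b0 uJ sF cI disj PF.
pose E (S : {set 'I_K}) := [set om | forall z, z \in [seq c (nat_of_ord k) | k <- enum S] ->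
  F (translate W z om)].
have mE S : measurable (E S).
  apply: measurable_forall_in => z _.
  exact: (measurable_cyl (measurable_translate mW z) sF).
have PE S : (P (E S) <= ((4^-1 ^+ b) ^+ #|S|)%:E)%E.
  have := @prob_translates _ _ _ _ _ _ mW lawW indW J F
    [seq c (nat_of_ord k) | k <- enum S] [::] (fun=> setT) sF uJ.
  rewrite rectT preimage_setT setTI -/(E S) probability_setT mul1e => ->//.
  - rewrite size_map -cardE; elim: #|S| => [|k IH]; first by [].
    by rewrite expeS exprS EFinM lee_pmul// expe_ge0.
  - by rewrite map_inj_uniq ?enum_uniq// => k k' /cI/val_inj.
  - move=> _ _ j j' /mapP[k _ ->] /mapP[k' _ ->] jJ j'J kk'.
    by rewrite (disj _ _ _ _ jJ j'J kk').
exists (\big[setU/set0]_(S : {set 'I_K} | (K %/ b < #|S|)%N) E S); split.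
- by apply: bigsetU_measurable => f _; exact: mE.
- apply: (le_trans (probability_bigsetU_le _ _ _ mE)).
  apply: (@le_trans _ _ (\sum_(S : {set 'I_K}) ((4^-1 ^+ b) ^+ (K %/ b).+1)%:E)%E).
    rewrite big_mkcond /=; apply: lee_sum => S _; case: ifPn => [Sf|_]; last first.
      by rewrite lee_fin !exprn_ge0// invr_ge0.
    apply: (le_trans (PE S)); rewrite lee_fin.
    by rewrite ler_wiXn2l ?exprn_ge0 ?exprn_ile1 ?invr_ge0 ?invf_le1 ?ler1n.
  rewrite sumEFin lee_fin sumr_const -cardsT -powersetT card_powerset cardsT card_ord.
  by rewrite -[leLHS]mulr_natl natrX; exact: two_quarter_pow.
move=> om nU; rewrite leqNgt; apply/negP => bK; apply: nU.
rewrite -bigcup_seq_cond; exists [set k : 'I_K | `[< F (translate W (c k) om) >]]%SET.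
  rewrite /= mem_index_enum /=; apply: leq_trans bK _.
  by rewrite -sum1_card [leqRHS]big_mkcond /=; apply: leq_sum => k _; rewrite inE; case: asbool.
by move=> _ /mapP[k + ->]; rewrite mem_enum inE => /asboolP.
Qed.

End union_bounds.

(** * Measurability of path events and passage times *)

Section measurability.
Context {R : realType}.

Lemma nat_above (x : R) : exists2 k, (0 < k)%N & x <= k%:R.
Proof.
exists (Num.truncn `|x|).+1 => //.
by apply: ltW; rewrite (le_lt_trans _ (truncnS_gt _))// ler_norm.
Qed.

(** Contains the labels of all horizontal edges crossed; vertical steps contribute a label too. *)
Definition support (u : vertex) (s : seq vertex) : seq vertex :=
  [seq (Order.min e.1.1 e.2.1, e.1.2) | e <- zip (u :: s) s].

Lemma measurable_path_time d (T : measurableType d) (V : T -> vertex -> R) u s :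
  (forall e, e \in support u s -> measurable_fun setT (fun x => V x e)) ->
  measurable_fun setT (fun x => path_time (V x) u s).
Proof.
elim: s u => [|z s IH] u mV.
  by under eq_fun do rewrite path_time_nil; exact: measurable_cst.
under eq_fun do rewrite path_time_cons.
apply: measurable_funD; last first.
  by apply: IH => e es; apply: mV; rewrite /support /= inE; apply/orP; right.
rewrite /edge_weight; case: eqP => _; first exact: measurable_cst.
by apply: mV; rewrite /support /= inE eqxx.
Qed.

(** Give the space of weight functions the sigma-algebra generated by [rects J]: the coordinates in
    [J] become measurable, hence so do the path times. *)
Lemma cyl_slow_paths (J : seq vertex) (ss : seq (seq vertex)) u (t : R) :
  (forall s e, s \in ss -> e \in support u s -> e \in J) ->
  <<s rects J >> [set w : vertex -> R | forall s, s \in ss -> t <= path_time w u s].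
Proof.
move=> ssJ; pose T := g_sigma_algebraType (@rects R J).
have mT e : e \in J -> measurable_fun setT (fun w : T => w e).
  move=> eJ _ A mA; rewrite setTI; apply: sub_sigma_algebra.
  exists (fun j => if j == e then A else setT); first by move=> j; case: ifP.
  apply/seteqP; split=> w /=; first by move=> /(_ e eJ); rewrite eqxx.
  by move=> wA j jJ; case: ifP => // /eqP->.
apply: (@measurable_forall_in _ _ T) => s sss.
have mp := @measurable_path_time _ T id u s (fun e es => mT e (ssJ s e sss es)).
rewrite (_ : (fun w : T => _) = setT `&` (fun w : T => path_time w u s) @^-1` `[t, +oo[%classic).
  exact: mp.
by apply/seteqP; split=> w /=; rewrite in_itv/= andbT; [split|case].
Qed.

Context {d} {Omega : measurableType d}.

(** A countable union along the enumeration of [I]; it applies to paths because finite sequences of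
    vertices are countable. *)
Lemma measurable_exists (I : countType) (A : I -> set Omega) :
  (forall i, measurable (A i)) -> measurable [set om | exists i, A i om].
Proof.
move=> mA; rewrite (_ : [set _ | _] =
    \bigcup_k (if @unpickle I k is Some i then A i else set0)).
  by apply: bigcupT_measurable => k; case: unpickle.
apply/seteqP; split=> om /=.
  by move=> [i Ai]; exists (pickle i) => //=; rewrite pickleK.
by move=> [k _]; case: unpickle => [i Ai|//]; exists i.
Qed.

Lemma measurable_forall (I : countType) (A : I -> set Omega) :
  (forall i, measurable (A i)) -> measurable [set om | forall i, A i om].
Proof.
move=> mA; rewrite (_ : [set _ | _] = ~` [set om | exists i, (~` A i) om]).
  by apply: measurableC; apply: measurable_exists => i; exact: measurableC.
apply/seteqP; split=> om /=; first by move=> Ai [i]; apply.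
by move=> nex i; apply: contrapT => nA; apply: nex; exists i.
Qed.

Lemma measurable_cst_prop (Q : Prop) : measurable [set _ : Omega | Q].
Proof.
have [hQ|hQ] := pselect Q.
  by rewrite (_ : [set _ | _] = setT)//; apply/seteqP; split.
by rewrite (_ : [set _ | _] = set0)//; apply/seteqP; split.
Qed.

Variable W : Omega -> vertex -> R.
Hypothesis mW : forall e : vertex, measurable_fun setT (fun om => W om e).

Lemma measurable_path_lt u s (t : R) :
  measurable [set om | path_time (W om) u s < t].
Proof.
have mp := @measurable_path_time _ _ W u s (fun e _ => mW e).
rewrite (_ : [set _ | _] = setT `&` (fun om => path_time (W om) u s) @^-1` `]-oo, t[%classic).
  exact: mp.
by apply/seteqP; split=> w /=; rewrite in_itv/=; [split|case].
Qed.

Lemma measurable_fast_path u z (t : R) :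
  measurable [set om | exists s, nn_path_from_to u z s /\ path_time (W om) u s < t].
Proof.
apply: measurable_exists => s; apply: measurableI; first exact: measurable_cst_prop.
exact: measurable_path_lt.
Qed.

(* [passage_time] is an [inf], hence [0] on the event where the path times are
   unbounded below, and that event must be shown measurable too. *)
Lemma measurable_passage_time_ge (n : nat) (y : int) (t : R) :
  measurable [set om | t <= passage_time (W om) (0, 0) (n%:Z, y)].
Proof.
pose z : vertex := (n%:Z, y).
pose LB := [set om | exists k : nat, forall s, ~ (nn_path_from_to (0, 0) z s /\
  path_time (W om) (0, 0) s < - k%:R)].
have mLB : measurable LB.
  apply: measurable_exists => k; apply: measurable_forall => s.
  apply: measurableC; apply: measurableI; first exact: measurable_cst_prop.
  exact: measurable_path_lt.
have mD := measurable_fast_path (0, 0) z t.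
set D := [set om | _] in mD.
(* Where path times are bounded below, the event says that no path is faster than [t]; elsewhere the
   infimum is 0 and the event reduces to [t <= 0]. *)
rewrite (_ : [set _ | _] = (LB `&` ~` D) `|` (~` LB `&` [set _ | t <= 0])).
  apply: measurableU; apply: measurableI => //; try exact: measurableC.
  exact: measurable_cst_prop.
have LBE om : LB om <-> has_lbound [set t' | exists s, nn_path_from_to (0, 0) z s /\
    t' = path_time (W om) (0, 0) s].
  split=> [[k lbk]|[x lbx]].
    exists (- k%:R) => _ [s [ps ->]]; rewrite leNgt; apply/negP => st.
    by apply: (lbk s).
  have [k _ xk] := nat_above (- x).
  exists k => s [ps]; apply/negP; rewrite -leNgt; apply: (@le_trans _ _ x); first by lra.
  by apply: lbx; exists s.
have [s0 ps0] : exists s, nn_path_from_to (0, 0) z s by exact: (path_exists (fun=> 0 : R)).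
apply/seteqP; split=> om /=.
  move=> tT; have [lb|nlb] := pselect (LB om).
    left; split=> // -[s [ps st]]; move: st; apply/negP; rewrite -leNgt.
    by apply: (le_trans tT); apply: ge_inf; [exact/LBE|exists s].
  right; split=> //; move: tT; rewrite /passage_time inf_out// => -[_].
  by move/LBE.
move=> [[lb nD]|[nlb t0]]; last first.
  by rewrite /passage_time inf_out// => -[_] /LBE.
by rewrite leNgt; apply/negP => /passage_time_lt.
Qed.

Variables (P : probability Omega R).

(** Continuity from below; [m0] allows the index to be taken arbitrarily large. *)
Lemma nondecreasing_prob_gt (A : nat -> set Omega) (x : R) m0 :
  (forall m, measurable (A m)) -> {homo A : m n / (m <= n)%N >-> m `<=` n} ->
  (x%:E < P (\bigcup_m A m))%E -> exists2 m, (m0 <= m)%N & (x%:E < P (A m))%E.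
Proof.
move=> mA ndA xP; apply: contrapT => nex.
have cv : P \o A @ \oo --> P (\bigcup_m A m).
  apply: nondecreasing_cvg_mu => //; first exact: bigcupT_measurable.
  by move=> m n mn; apply/subsetPset; exact: ndA.
have : (limn (P \o A) <= x%:E)%E.
  apply: lime_le; first by apply/cvg_ex; eexists; exact: cv.
  exists m0 => // m /= m0m; rewrite leNgt; apply/negP => xm; apply: nex.
  by exists m.
by rewrite (cvg_lim _ cv)// leNgt xP.
Qed.

End measurability.

(** * Deterministic block estimate and conversion of rates *)

Section block_estimate.
Context {R : realType}.

(** The four errors of size [n * e] are the excess on good blocks, the bad blocks, the climbs, and
    the rounding of block heights. The last incomplete stretch, of length [r < Q * M], and the final
    ceiling give the additive constant. *)
Lemma passage_time_blocks (w : vertex -> R) (M Q K r a b h : nat) (L lam e v : R)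
    (i : nat -> nat) (bad : pred nat) :
  (forall e, 0 <= w e) -> 0 <= v -> 0 <= L -> 0 <= lam + e -> 0 < e ->
  (r < Q * M)%N -> h%:Z = Num.ceil (v * M%:R) ->
  2 <= a%:R * e -> L + v + 1 <= b%:R * e -> 1 <= M%:R * e -> (0 < M)%N ->
  (\sum_(0 <= x < K * Q * M + r) i x <= (K * Q * M + r) %/ a)%N ->
  (forall x, (x < K * Q * M + r)%N ->
     w (x%:Z, (minn (x %/ M) (K * Q) * h)%N%:Z + (i x)%:Z) <= L) ->
  (\sum_(k < K * Q) bad k <= Q * (K %/ b))%N ->
  (forall k, (k < K * Q)%N -> ~~ bad k ->
     reach w ((k * M)%N%:Z, (k * h)%N%:Z) ((k.+1 * M)%N%:Z, (k.+1 * h)%N%:Z)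
       (M%:R * (lam + e))) ->
  passage_time w (0, 0) ((K * Q * M + r)%N%:Z, Num.ceil (v * (K * Q * M + r)%N%:R)) <=
  (K * Q * M + r)%N%:R * (lam + 4 * e) + ((L + v) * (Q * M)%N%:R + 1).
Proof.
move=> w0 v0 L0 le0 e0 rQM hE ae be Me M0 iS wL badS good.
set k := (K * Q)%N in iS wL badS good *.
set n := (k * M + r)%N in iS wL *.
have m1 : 1 <= M%:R :> R by rewrite ler1n.
have g0 : 0 <= M%:R * (lam + e) by rewrite mulr_ge0.
have path1 : reach w (0, 0) (n%:Z, (k * h)%N%:Z)
    (k%:R * (M%:R * (lam + e)) + (\sum_(j < k) bad j)%N%:R * (L * M%:R + h%:R) +
     2 * (\sum_(0 <= x < n) i x)%N%:R + L * r%:R).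
  apply: (@reach_blocks R w M k r h (fun x => (minn (x %/ M) k * h)%N%:Z)) => //.
    move=> k' j kK jM; rewrite divnMDl// divn_small// addn0.
    by rewrite (minn_idPl (ltnW kK)).
  by move=> j jr; rewrite divnMDl// (minn_idPr (leq_addr _ _)).
have vert := reach_vertical w n%:Z (k * h)%N%:Z (Num.ceil (v * n%:R)).
have {path1 vert} := passage_time_le w0 (reach_trans path1 vert).
move=> /le_trans; apply.
set S := (\sum_(j < _) _)%N in badS *; set I := (\sum_(0 <= x < n) _)%N in iS *.
have nE : n%:R = k%:R * M%:R + r%:R :> R by rewrite natrD natrM.
have r0 : 0 <= r%:R :> R by [].
have rle : r%:R <= (Q * M)%N%:R :> R by rewrite ler_nat ltnW.
have k0 : 0 <= k%:R :> R by [].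
have hE' : h%:R = (Num.ceil (v * M%:R))%:~R :> R by rewrite -hE.
have hle : h%:R <= v * M%:R + 1.
  by rewrite hE'; have /andP[+ _] := ceil_itv (v * M%:R); lra.
have hge : v * M%:R <= h%:R by rewrite hE'; exact: ceil_ge.
have SB : S%:R * b%:R <= k%:R :> R.
  rewrite -natrM ler_nat /k; apply: (leq_trans (leq_mul badS (leqnn b))).
  by rewrite -mulnA mulnC leq_mul2r leq_trunc_div orbT.
have IA : I%:R * a%:R <= n%:R :> R.
  by rewrite -natrM ler_nat; apply: (leq_trans (leq_mul iS (leqnn a))); exact: leq_trunc_div.
have S0 : 0 <= S%:R :> R by [].
have I0 : 0 <= I%:R :> R by [].
have T1 : k%:R * (M%:R * (lam + e)) <= n%:R * (lam + e).
  by rewrite mulrA ler_wpM2r// nE; lra.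
(* A bad block costs at most [M * (L + v + 1) <= M * b * e], and at most [k / b] blocks are bad. *)
have T2 : S%:R * (L * M%:R + h%:R) <= n%:R * e.
  apply: (@le_trans _ _ (S%:R * (M%:R * (b%:R * e)))).
    by apply: ler_wpM2l => //; nra.
  apply: (@le_trans _ _ (k%:R * M%:R * e)); first by nra.
  by rewrite ler_wpM2r ?(ltW e0)// nE; lra.
have T3 : 2 * I%:R <= n%:R * e by nra.
have T4 : L * r%:R <= L * (Q * M)%N%:R by exact: ler_wpM2l.
(* Rounding costs at most 1 per block, in total at most [k <= k * M * e <= n * e]. *)
have T5 : `|Num.ceil (v * n%:R) - (k * h)%N%:Z|%:~R <= n%:R * e + (v * (Q * M)%N%:R + 1).
  rewrite intr_norm intrB ler_norml.
  have /andP[c1 c2] := ceil_itv (v * n%:R).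
  have kh : (k * h)%N%:Z%:~R = k%:R * h%:R :> R by rewrite -natrM.
  rewrite kh.
  have kh1 : k%:R * h%:R <= v * n%:R + n%:R * e by rewrite nE; nra.
  have kh2 : v * n%:R <= k%:R * h%:R + v * (Q * M)%N%:R by rewrite nE; nra.
  have v1 : 0 <= v * (Q * M)%N%:R by rewrite mulr_ge0.
  have v2 : 0 <= n%:R * e by rewrite mulr_ge0// ltW.
  by apply/andP; split; lra.
by nra.
Qed.

(** With [B = ln 2 / N], the factor 2 in [A] pays for the rounding in [n %/ N], and [expR (B * n0)]
    covers [n < n0], where [p <= 1] suffices. *)
Lemma geometric_to_exp (C : R) (N n0 : nat) : 0 < C -> (0 < N)%N ->
  exists A B : R, [/\ 0 < A, 0 < B & forall n (p : \bar R), (p <= 1)%E ->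
    ((n0 <= n)%N -> (p <= (C * 2^-1 ^+ (n %/ N))%:E)%E) ->
    (p <= (A * expR (- (B * n%:R)))%:E)%E].
Proof.
move=> C0 N0; pose B : R := ln 2 / N%:R.
have N0' : 0 < N%:R :> R by rewrite ltr0n.
have B0 : 0 < B by rewrite divr_gt0// ln_gt0// ltr1n.
exists (2 * C + expR (B * n0%:R)), B; split=> //.
  by rewrite addr_gt0 ?expR_gt0// mulr_gt0.
move=> n p p1 pC; have [n0n|nn0] := leqP n0 n.
  apply: (le_trans (pC n0n)); rewrite lee_fin.
  have E : 2^-1 ^+ (n %/ N).+1 <= expR (- (B * n%:R)).
    rewrite -[2^-1 in leLHS]lnK ?posrE ?invr_gt0//.
    rewrite -expRM_natl ler_expR lnV ?posrE// mulrN lerN2 /B mulrAC ler_pdivrMr//.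
    rewrite [leRHS]mulrAC [leRHS]mulrC -natrM ler_wpM2l ?ln_ge0 ?ler1n// ler_nat.
    by rewrite ltnW// ltn_ceil.
  rewrite exprS in E; have := expR_gt0 (B * n0%:R); have := expR_gt0 (- (B * n%:R)).
  nra.
apply: (le_trans p1); rewrite lee_fin mulrDl -expRD.
have h : 1 <= expR (B * n0%:R - B * n%:R).
  rewrite -[leLHS]expR0 ler_expR -mulrBr; apply: mulr_ge0; first exact: ltW.
  by rewrite subr_ge0 ler_nat ltnW.
by have := expR_gt0 (- (B * n%:R)); nra.
Qed.

End block_estimate.

(** * Exponential upper tail in a fixed direction *)

Section upper_tail.
Context {R : realType} {d} {Omega : measurableType d}.
Variables (P : probability Omega R) (G : probability R R) (W : Omega -> vertex -> R).
Hypothesis G0 : G [set x : R | 0 <= x] = 1%E.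
Hypothesis mW : forall e : vertex, measurable_fun setT (fun om => W om e).
Hypothesis lawW : forall (e : vertex) (A : set R), measurable A ->
  P ((fun om => W om e) @^-1` A) = G A.
Hypothesis indW : mutually_independent P (fun (e : vertex) om => W om e).

Local Notation T om n y := (passage_time (W om) (0, 0) (n%:Z, y)).

(** Weights are nonnegative only almost surely; this null event is set aside so that the path lemmas
    apply pointwise. *)
Definition negative_weight : set Omega := [set om | exists e, W om e < 0].

Lemma measurable_weight_lt0 e : measurable [set om | W om e < 0].
Proof.
rewrite (_ : [set _ | _] = setT `&` (fun om => W om e) @^-1` `]-oo, 0[%classic).
  exact: mW.
by apply/seteqP; split=> om /=; rewrite in_itv/=; [split|case].
Qed.

Lemma measurable_negative_weight : measurable negative_weight.
Proof. by apply: measurable_exists => e; exact: measurable_weight_lt0. Qed.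

Lemma negative_weight_null : P negative_weight = 0%E.
Proof.
apply/negligibleP; first exact: measurable_negative_weight.
have -> : negative_weight =
    \bigcup_k (if @unpickle vertex k is Some e then [set om | W om e < 0] else set0).
  apply/seteqP; split=> om /=.
    by move=> [i Ai]; exists (pickle i) => //=; rewrite pickleK.
  by move=> [k _]; case: unpickle => [i Ai|//]; exists i.
apply: negligible_bigcup => k; case: unpickle => [e|]; last exact: negligible_set0.
have m0 : measurable [set x : R | 0 <= x].
  by rewrite (_ : [set _ | _] = `[0, +oo[%classic)//; apply/seteqP; split=> x /=;
    rewrite in_itv/= andbT.
have E : [set om | W om e < 0] = (fun om => W om e) @^-1` (~` [set x : R | 0 <= x]).
  by apply/seteqP; split=> om /=; rewrite ltNge => /negP.
apply/negligibleP; first exact: measurable_weight_lt0.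
rewrite E; apply: (etrans (lawW e (measurableC m0))).
by rewrite probability_setC// G0 subee.
Qed.

Lemma not_negative_weight om : ~ negative_weight om -> forall e, 0 <= W om e.
Proof. by move=> nW e; rewrite leNgt; apply/negP => We; apply: nW; exists e. Qed.

Lemma light_threshold (delta : R) : 0 < delta ->
  exists2 L : R, 0 <= L & (G [set x : R | (L < x)%R] <= delta%:E)%E.
Proof.
move=> delta0; pose A (m : nat) := [set x : R | x <= m%:R].
have mA m : measurable (A m).
  by rewrite /A (_ : [set _ | _] = `]-oo, m%:R]%classic)//; apply/seteqP; split=> x /=;
    rewrite in_itv/=.
have AT : \bigcup_m A m = setT.
  apply/seteqP; split=> // x _.
  by have [k _ xk] := nat_above x; exists k.
have [||m _ PA] := @nondecreasing_prob_gt R _ _ G A (1 - delta) 0%N mA.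
- move=> m n mn x; rewrite /A /= => xm; by rewrite (le_trans xm)// ler_nat.
- by rewrite AT probability_setT lte_fin; lra.
exists m%:R => //; rewrite (_ : [set _ | _] = ~` A m).
  rewrite probability_setC//; move: PA; rewrite -(fineK (fin_num_measure G _ (mA m))).
  by rewrite lte_fin -EFinB lee_fin; lra.
by apply/seteqP; split=> x /=; rewrite ltNge => /negP.
Qed.

Variables (v Lv : R).
Hypothesis v0 : 0 <= v.
Hypothesis cvgT : {ae P, forall om,
  (fun n : nat => T om n (Num.ceil (v * n%:R)) / n%:R) @ \oo --> Lv}.

Definition supports (ss : seq (seq vertex)) : seq vertex :=
  undup (flatten [seq support (0, 0) s | s <- ss]).

(** The event that a block is bad; restricting to a finite list of crossings makes it a cylinder. *)
Definition slow (ss : seq (seq vertex)) (t : R) : set (vertex -> R) :=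
  [set w | forall s, s \in ss -> t <= path_time w (0, 0) s].

Lemma cyl_slow ss t : <<s rects (supports ss) >> (slow ss t).
Proof.
apply: cyl_slow_paths => s e sss es; rewrite mem_undup; apply/flattenP.
by exists (support (0, 0) s) => //; exact: map_f.
Qed.

Lemma measurable_slow ss t : measurable (W @^-1` slow ss t).
Proof. exact: (measurable_cyl mW (@cyl_slow ss t)). Qed.

(** Two limits from below: almost surely fast paths exist for all large sizes, so some fixed [M]
    works with high probability; then finite lists exhaust the paths of that size, so one list
    suffices. *)
Lemma good_block (eps rho : R) (M0 : nat) : 0 < eps -> 0 < rho ->
  exists M ss, [/\ (M0 <= M)%N,
    forall s, s \in ss -> nn_path_from_to (0, 0) (M%:Z, Num.ceil (v * M%:R)) s &
    (P (W @^-1` slow ss (M%:R * (Lv + eps))) <= rho%:E)%E].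
Proof.
move=> eps0 rho0.
pose z (n : nat) : vertex := (n%:Z, Num.ceil (v * n%:R)).
pose D n := [set om | exists s, nn_path_from_to (0, 0) (z n) s /\
  path_time (W om) (0, 0) s < n%:R * (Lv + eps)].
have mD n : measurable (D n) by exact: measurable_fast_path.
pose B m := [set om | forall k, D (m + k)%N om].
have mB m : measurable (B m) by apply: measurable_forall => k; exact: mD.
have PB : P (\bigcup_m B m) = 1%E.
  have mBU : measurable (\bigcup_m B m) by exact: bigcupT_measurable.
  suff PC : P (~` \bigcup_m B m) = 0%E.
    by rewrite -[\bigcup_m B m]setCK probability_setC ?PC ?sube0//; exact: measurableC.
  apply/negligibleP; first exact: measurableC.
  apply: negligibleS cvgT => om /= nB cv; apply: nB.
  have [N _ TN] := cvgr_lt _ cv (Lv + eps) (ltac:(by rewrite ltrDl)).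
  (* The successor keeps the divisor positive. *)
  exists N.+1 => // k; apply: passage_time_lt.
  have Nk : (N <= N.+1 + k)%N by rewrite (leq_trans (leqnSn N))// leq_addr.
  by have := TN _ Nk; rewrite /= ltr_pdivrMr ?ltr0n// [ltRHS]mulrC.
have [||M M0M PM] := @nondecreasing_prob_gt R _ _ P B (1 - rho) M0 mB.
- by move=> m n mn om /= Bm k; rewrite -(subnKC mn) -addnA; exact: Bm.
- by rewrite PB lte_fin; lra.
pose t := M%:R * (Lv + eps).
(* The paths to [z M] whose code in the enumeration of sequences is below [m]. *)
pose ss m := [seq s <- pmap unpickle (iota 0 m) | nn_path_from_to (0, 0) (z M) s].
have mA m : measurable (~` (W @^-1` slow (ss m) t)).
  by apply: measurableC; exact: measurable_slow.
have ssM m n : (m <= n)%N -> {subset ss m <= ss n}.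
  move=> mn s; rewrite !mem_filter => /andP[-> /=].
  rewrite !mem_pmap => /mapP[i im ->]; apply: map_f.
  by move: im; rewrite !mem_iota !add0n => /leq_trans; exact.
have [||m _ Pm] := @nondecreasing_prob_gt R _ _ P _ (1 - rho) 0%N mA.
- by move=> m n mn om /= sm sn; apply: sm => s /(ssM _ _ mn); exact: sn.
- apply: (lt_le_trans PM); apply: le_measure; rewrite ?inE//.
    exact: bigcupT_measurable.
  move=> om /(_ 0%N); rewrite addn0 => -[s [ps st]].
  exists (pickle s).+1 => //= /(_ s); rewrite leNgt st.
  suff -> : s \in ss (pickle s).+1 by move=> /(_ isT).
  rewrite mem_filter ps mem_pmap -(@pickleK _ s) map_f// mem_iota add0n.
  exact: ltnSn.
exists M, (ss m); split=> //.
  by move=> s; rewrite mem_filter => /andP[].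
move: Pm; rewrite probability_setC; last exact: measurable_slow.
rewrite -(fineK (fin_num_measure P _ (measurable_slow (ss m) t))).
by rewrite -EFinB lte_fin lee_fin; lra.
Qed.

Definition block (M h k : nat) : vertex := ((k * M)%N%:Z, (k * h)%N%:Z).

(** Abscissas in [J] differ by less than [Q], while distinct blocks of one residue class are at
    least [Q * M] apart horizontally. *)
Lemma block_translates_disjoint (J : seq vertex) M h Q c : (0 < M)%N ->
  (forall j, j \in J -> (`|j.1| * 2 < Q)%N) ->
  forall k k' (j j' : vertex), j \in J -> j' \in J ->
    j + block M h (k * Q + c) = j' + block M h (k' * Q + c) -> k = k'.
Proof.
move=> M0 JQ.
have key k k' (j j' : vertex) : j \in J -> j' \in J ->
    j + block M h (k * Q + c) = j' + block M h (k' * Q + c) -> ~ (k < k')%N.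
  move=> /JQ jQ /JQ j'Q [jj' _] kk'.
  have le1 : ((k * Q + c) * M + Q <= (k' * Q + c) * M)%N.
    apply: (@leq_trans ((k.+1 * Q + c) * M)%N); first by nia.
    by rewrite leq_mul2r leq_add2r leq_mul2r kk' !orbT.
  by move: jj' jQ j'Q le1; rewrite /=; lia.
move=> k k' j j' jJ j'J jj'; case: (ltngtP k k') => // kk'.
  by have := key _ _ _ _ jJ j'J jj' kk'.
by have := key _ _ _ _ j'J jJ (esym jj') kk'.
Qed.

Lemma block_inj M h Q c : (0 < M)%N -> (0 < Q)%N ->
  injective (fun k => block M h (k * Q + c)).
Proof.
move=> M0 Q0 k k' [/eqP]; rewrite eqn_pmul2r// eqn_add2r eqn_pmul2r//.
by move=> /eqP.
Qed.

(** Regroups block indices modulo [Q], since bad blocks are controlled one residue class at a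
    time. *)
Lemma sum_residues (f : nat -> nat) K Q b :
  (forall c, (c < Q)%N -> (\sum_(k < K) f (k * Q + c)%N <= b)%N) ->
  (\sum_(k < K * Q) f k <= Q * b)%N.
Proof.
move=> fb; rewrite -(big_mkord xpredT f) big_nat_mul big_mkord.
rewrite (eq_bigr (fun k : 'I_K => (\sum_(c < Q) f (k * Q + c))%N)); last first.
  move=> k _; rewrite -{1}[(k * Q)%N]addn0 mulSn addnC (addnC Q) big_addn addnC.
  by rewrite addnK big_mkord; apply: eq_bigr => c _; rewrite addnC.
rewrite exchange_big /= -[Q in leqRHS]card_ord -sum_nat_const.
by apply: leq_sum => c _; exact: fb.
Qed.

Lemma upper_tail_at (eps : R) : 0 < eps ->
  exists A B : R, [/\ 0 < A, 0 < B & forall n : nat,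
    (P [set om | (n%:R * (Lv + eps) <= T om n (Num.ceil (v * n%:R)))%R] <=
     (A * expR (- (B * n%:R)))%:E)%E].
Proof.
(* The block estimate loses [4 * e]; the other [4 * e] absorbs its additive constant for large
   [n]. *)
move=> eps0; pose e := eps / 8; have e0 : 0 < e by rewrite divr_gt0.
have [a a0] := nat_above (2 / e); rewrite ler_pdivrMr// => ae.
have [L L0 GL] := @light_threshold ((4^-1 ^+ a) ^+ 2) (ltac:(by rewrite !exprn_gt0)).
have [b b0] := nat_above ((L + v + 1) / e); rewrite ler_pdivrMr// => be.
have [M0 M00] := nat_above (1 / e); rewrite ler_pdivrMr// => Me.
have rho0 : 0 < 4^-1 ^+ b :> R by rewrite exprn_gt0.
have [M [ss [M0M pss Pss]]] := good_block M0 e0 rho0.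
have {M00} M_gt0 : (0 < M)%N := leq_trans M00 M0M.
have {M0 M0M} {}Me : 1 <= M%:R * e.
  by apply: (le_trans Me); rewrite ler_wpM2r ?(ltW e0)// ler_nat.
pose h := `|Num.ceil (v * M%:R)|%N.
have hE : h%:Z = Num.ceil (v * M%:R).
  by rewrite gez0_abs// ceil_ge0 (lt_le_trans (ltrN10 _))// mulr_ge0.
set F := slow ss _ in Pss; pose J := supports ss.
pose Q := (\sum_(j <- J) `|j.1| * 2).+1%N.
have JQ j : j \in J -> (`|j.1| * 2 < Q)%N.
  by move=> jJ; rewrite ltnS (big_rem j jJ) leq_addr.
(* Some sample point has nonnegative weights and lies outside [F]; were the threshold negative,
   every path would be slow there. *)
have le0 : 0 <= Lv + e.
  have [om] : (~` (negative_weight `|` W @^-1` F)) !=set0.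
    apply/set0P/negP => /eqP E0.
    have mF := measurable_slow ss (M%:R * (Lv + e)).
    have : (P setT <= 0 + (4^-1 ^+ b)%:E)%E.
      rewrite -setC0 -E0 setCK; apply: probability_setU_le => //.
        exact: measurable_negative_weight.
      by rewrite negative_weight_null.
    by rewrite probability_setT add0e lee_fin leNgt exprn_ilt1 ?invr_ge0 ?invf_lt1
      ?ltr1n// -lt0n b0.
  move=> /not_orP[/not_negative_weight w0]; rewrite /F /slow /= => nF.
  rewrite leNgt; apply/negP => lt0; apply: nF => s _.
  by apply: le_trans (path_time_ge0 _ _ w0); rewrite mulr_ge0_le0// ltW.
(* The 2, against the 1 of the block estimate, makes the final contradiction strict. *)
have [n0 _] := nat_above (((L + v) * (Q * M)%N%:R + 2) / (4 * e)).
rewrite ler_pdivrMr ?mulr_gt0// => n0C.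
have QM0 : (0 < Q * M)%N by rewrite muln_gt0.
(* With [K = n %/ (Q * M)], each of the [Q] residue classes fails with probability at most
   [2^-1 ^+ K], and so do the columns. *)
have [A [B [A0 B0 AB]]] := @geometric_to_exp R (Q.+1)%:R (Q * M) n0 (ltr0Sn _ _) QM0.
exists A, B; split=> // n.
have mT := measurable_passage_time_ge mW n (Num.ceil (v * n%:R)) (n%:R * (Lv + eps)).
apply: AB => [|n0n]; first exact: probability_le1.
set K := (n %/ (Q * M))%N; pose r := (n %% (Q * M))%N.
have nE : n = (K * Q * M + r)%N by rewrite -mulnA -divn_eq.
pose y x := (minn (x %/ M) (K * Q) * h)%N%:Z.
have [U1 [mU1 PU1 hU1]] := light_columns mW lawW indW n y a0 GL.
have [U2 hU2] := choice (fun c => @few_bad_translates _ _ _ _ _ _ mW lawW indW J F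
  (fun k => block M h (k * Q + c)) K b b0 (undup_uniq _) (@cyl_slow ss _)
  (@block_inj M h Q c M_gt0 (ltn0Sn _)) (@block_translates_disjoint J M h Q c M_gt0 JQ) Pss).
have mU2 c : measurable (U2 c) by have [] := hU2 c.
pose U := negative_weight `|` (U1 `|` \big[setU/set0]_(c < Q) U2 c).
have mbig : measurable (\big[setU/set0]_(c < Q) U2 c) by exact: bigsetU_measurable.
have mneg := measurable_negative_weight.
have mU : measurable U by apply: measurableU => //; exact: measurableU.
apply: (@le_trans _ _ (P U)).
  apply: le_measure; rewrite ?inE//.
  move=> om /= tail; apply: contrapT => /not_orP[/not_negative_weight w0 /not_orP[]].
  move=> /hU1[i [iS wL]] nU2.
  pose bad k := `[< F (translate W (block M h k) om) >].
  have badS : (\sum_(k < K * Q) bad k <= Q * (K %/ b))%N.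
    apply: (sum_residues (f := fun k => nat_of_bool (bad k))) => c cQ.
    have [_ _] := hU2 c; apply => Uc; apply: nU2.
    by rewrite -bigcup_mkord; exists c.
  have good k : (k < K * Q)%N -> ~~ bad k ->
      reach (W om) ((k * M)%N%:Z, (k * h)%N%:Z) ((k.+1 * M)%N%:Z, (k.+1 * h)%N%:Z)
        (M%:R * (Lv + e)).
    move=> _ /asboolPn nF.
    have [s] : exists s, ~ (s \in ss -> M%:R * (Lv + e) <=
        path_time (translate W (block M h k) om) (0, 0) s).
      by apply/existsNP.
    move=> /not_implyP[sss /negP]; rewrite -ltNge => st.
    have := @reach_shift R (W om) (block M h k) (0, 0) (M%:Z, h%:Z) (M%:R * (Lv + e)).
    have -> : (0, 0) + block M h k = ((k * M)%N%:Z, (k * h)%N%:Z) :> vertex.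
      by rewrite add0r.
    have -> : (M%:Z, h%:Z) + block M h k = ((k.+1 * M)%N%:Z, (k.+1 * h)%N%:Z) :> vertex.
      by congr (_, _); rewrite /= mulSn PoszD.
    by apply; exists s; split; [rewrite hE; exact: pss|exact: ltW].
  rewrite nE in iS wL.
  have := @passage_time_blocks R (W om) M Q K r a b h L Lv e v i bad w0 v0 L0 le0 e0
    (ltn_pmod _ QM0) hE ae be Me M_gt0 iS wL badS good.
  rewrite -nE => /(le_trans tail) bound.
  have nC : (L + v) * (Q * M)%N%:R + 2 <= n%:R * (4 * e).
    by apply: (le_trans n0C); rewrite ler_wpM2r ?ler_nat// mulr_ge0// ltW.
  by move: bound; rewrite (_ : eps = 8 * e); [lra|rewrite /e; lra].
have Kn : (K <= n)%N by exact: leq_div.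
have P2 : (P (\big[setU/set0]_(c < Q) U2 c) <= (Q%:R * 2^-1 ^+ K)%:E)%E.
  apply: (le_trans (probability_bigsetU_le P _ _ (fun c : 'I_Q => mU2 c))).
  have -> : Q%:R * 2^-1 ^+ K = \sum_(c < Q) 2^-1 ^+ K :> R.
    by rewrite sumr_const card_ord mulr_natl.
  by rewrite -sumEFin; apply: lee_sum => c _; have [] := hU2 c.
rewrite -nat1r mulrDl mul1r EFinD -[leRHS]add0e.
apply: probability_setU_le => //; first exact: measurableU.
  by rewrite negative_weight_null.
apply: probability_setU_le => //; apply: (le_trans PU1).
by rewrite lee_fin ler_wiXn2l// ?invr_ge0// invf_le1// ler1n.
Qed.

End upper_tail.

(** * Lipschitz dependence on the direction *)

Section uniformity.
Context {R : realType}.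

Lemma ceil_dist (x y : R) : `|Num.ceil x - Num.ceil y|%:~R <= `|x - y| + 1.
Proof.
rewrite intr_norm intrB.
have /andP[x1 x2] := ceil_itv x; have /andP[y1 y2] := ceil_itv y.
by have := ler_norm (x - y); have := ler_norm (- (x - y)); rewrite normrN ler_norml; lra.
Qed.

Lemma passage_time_direction (w : vertex -> R) (n : nat) (u v : R) :
  (forall e, 0 <= w e) ->
  passage_time w (0, 0) (n%:Z, Num.ceil (u * n%:R)) <=
  passage_time w (0, 0) (n%:Z, Num.ceil (v * n%:R)) + (`|u - v| * n%:R + 1).
Proof.
move=> w0; apply: le_trans (passage_time_vertical _ (Num.ceil (v * n%:R)) _ w0) _.
rewrite lerD2l; apply: le_trans (ceil_dist _ _) _.
by rewrite -mulrBl normrM (ger0_norm (ler0n _ _)).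
Qed.

(** The rounding error 1 in [passage_time_direction] vanishes after division by [n]. *)
Lemma limit_direction (w : vertex -> R) (u v lu lv : R) :
  (forall e, 0 <= w e) ->
  (fun n : nat => passage_time w (0, 0) (n%:Z, Num.ceil (u * n%:R)) / n%:R) @ \oo --> lu ->
  (fun n : nat => passage_time w (0, 0) (n%:Z, Num.ceil (v * n%:R)) / n%:R) @ \oo --> lv ->
  lu <= lv + `|u - v|.
Proof.
move=> w0 cu cv; rewrite leNgt; apply/negP => gap.
pose e := (lu - (lv + `|u - v|)) / 3; have e0 : 0 < e by rewrite divr_gt0// subr_gt0.
have [N1 _ h1] := cvgr_gt _ cu (lu - e) (ltac:(by rewrite ltrBlDr ltrDl)).
have [N2 _ h2] := cvgr_lt _ cv (lv + e) (ltac:(by rewrite ltrDl)).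
have [N3 N30] := nat_above (1 / e); rewrite ler_pdivrMr// => N3e.
pose n := (N1 + N2 + N3)%N.
have n0 : 0 < n%:R :> R by rewrite ltr0n addn_gt0 N30 orbT.
have /= := h1 n (ltac:(rewrite /= /n; lia)); rewrite ltr_pdivlMr// => {}h1.
have /= := h2 n (ltac:(rewrite /= /n; lia)); rewrite ltr_pdivrMr// => {}h2.
have d := passage_time_direction n u v w0.
have n3 : 1 <= n%:R * e.
  by apply: (le_trans N3e); rewrite ler_wpM2r ?(ltW e0)// ler_nat /n leq_addl.
have E : lu = lv + `|u - v| + 3 * e by rewrite /e; lra.
by rewrite E in h1; nra.
Qed.

End uniformity.

(** * From a finite grid to all directions *)

Unset Implicit Arguments.

Theorem theorem3p7 (R : realType) (d : measure_display) (Omega : measurableType d)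
  (P : probability Omega R) (G : probability R R)
  (W : Omega -> vertex -> R) (Lambda : R -> R) :
  G [set x : R | 0 <= x] = 1%E ->
  (forall e : vertex, measurable_fun setT (fun om => W om e)) ->
  (forall (e : vertex) (A : set R), measurable A ->
     P ((fun om => W om e) @^-1` A) = G A) ->
  mutually_independent P (fun (e : vertex) om => W om e) ->
  (forall v : R, 0 <= v ->
     {ae P, forall om,
        (fun n : nat => passage_time (W om) (0, 0) (n%:Z, Num.ceil (v * n%:R)) / n%:R)
          @ \oo --> Lambda v}) ->
  forall eps : R, 0 < eps -> forall v0 : R, 0 <= v0 ->
  exists A B : R, 0 < A /\ 0 < B /\
    forall n : nat, (1 <= n)%N -> forall v : R, 0 <= v <= v0 ->
      (P [set om | (n%:R * (Lambda v + eps)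
                     <= passage_time (W om) (0, 0) (n%:Z, Num.ceil (v * n%:R)))%R]
        <= (A * expR (- (B * n%:R)))%:E)%E.
Proof.
move=> G0 mW lawW indW cvgT eps eps0 v0 v00.
(* Moving to a grid direction costs [eta] in [Lambda], [eta] in the passage time and [eta] for
   rounding, which leaves [3 * eta = eps / 2]. *)
pose eta := eps / 6; have eta0 : 0 < eta by rewrite divr_gt0.
(* Common constants for finitely many directions: amplitudes are added and the smaller rate is
   kept. *)
have grid k0 : exists A B : R, [/\ 0 < A, 0 < B & forall (k n : nat), (k < k0)%N ->
    (P [set om | (n%:R * (Lambda (k%:R * eta) + eps / 2) <=
      passage_time (W om) (0, 0) (n%:Z, Num.ceil (k%:R * eta * n%:R)))%R] <=
     (A * expR (- (B * n%:R)))%:E)%E].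
  elim: k0 => [|k0 [A [B [A0 B0 AB]]]]; first by exists 1, 1; split.
  have u0 : 0 <= k0%:R * eta by rewrite mulr_ge0// ltW.
  have [A' [B' [A'0 B'0 AB']]] := upper_tail_at G0 mW lawW indW u0 (cvgT _ u0)
    (ltac:(by rewrite divr_gt0) : 0 < eps / 2).
  exists (A + A'), (Num.min B B'); split; first exact: addr_gt0.
    by rewrite lt_min B0.
  have le_exp C C' b n : 0 <= C -> C <= C' -> Num.min B B' <= b ->
      ((C * expR (- (b * n%:R)))%:E <= (C' * expR (- (Num.min B B' * n%:R)))%:E)%E.
    move=> C0 CC' bb; rewrite lee_fin ler_pM ?expR_ge0// ler_expR lerN2.
    exact: ler_wpM2r.
  move=> k n; rewrite ltnS leq_eqVlt => /predU1P[->|kk0].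
    by apply: (le_trans (AB' n)); apply: le_exp; rewrite ?ge_min ?lexx ?orbT//; lra.
  by apply: (le_trans (AB k n kk0)); apply: le_exp; rewrite ?ge_min ?lexx//; lra.
have [k0 _] := nat_above (v0 / eta); rewrite ler_pdivrMr// => k0v.
have [A [B [A0 B0 AB]]] := grid k0.+1.
have [n0 _] := nat_above (1 / eta); rewrite ler_pdivrMr// => n0e.
exists (A + expR (B * n0%:R)), B; split; first by rewrite addr_gt0// expR_gt0.
split=> // n _ v /andP[v_ge0 vv0].
have mT (u x : R) : measurable [set om | (x <=
    passage_time (W om) (0, 0) (n%:Z, Num.ceil (u * n%:R)))%R].
  exact: measurable_passage_time_ge.
have [nn0|n0n] := ltnP n n0.
  apply: (le_trans (probability_le1 P (mT _ _))); rewrite lee_fin mulrDl -expRD.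
  have h : 1 <= expR (B * n0%:R - B * n%:R).
    rewrite -[leLHS]expR0 ler_expR -mulrBr mulr_ge0 ?(ltW B0)//.
    by rewrite subr_ge0 ler_nat ltnW.
  by have := expR_gt0 (- (B * n%:R)); nra.
(* [u] is the grid direction just below [v]. *)
pose k := Num.truncn (v / eta); pose u := k%:R * eta.
have veta : 0 <= v / eta by rewrite divr_ge0// ltW.
have /andP[ku uk] := truncn_itv veta.
have uv : u <= v by rewrite /u -ler_pdivlMr.
have vu : v < u + eta.
  by move: uk; rewrite ltr_pdivrMr// -/k -natr1 mulrDl mul1r.
have kk0 : (k < k0.+1)%N.
  by rewrite ltnS -(ler_nat R) -(ler_pM2r eta0) (le_trans uv)// (le_trans vv0).
have u0 : 0 <= u by rewrite mulr_ge0// ltW.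
have mneg := measurable_negative_weight mW.
have neg0 := negative_weight_null G0 mW lawW.
have Luv : Lambda u <= Lambda v + (v - u).
  (* As [Lambda] is deterministic, one sample point where both limits hold and no weight is negative
     suffices. *)
  have [om [[cu cv] w0]] : exists om,
    ((fun n : nat => passage_time (W om) (0, 0) (n%:Z, Num.ceil (u * n%:R)) / n%:R)
          @ \oo --> Lambda u /\
     (fun n : nat => passage_time (W om) (0, 0) (n%:Z, Num.ceil (v * n%:R)) / n%:R)
          @ \oo --> Lambda v) /\ ~ negative_weight W om.
    have aeN : {ae P, forall om, ~ negative_weight W om}.
      apply: (negligibleS _ (_ : P.-negligible (negative_weight W))).
        by move=> om /= /contrapT.
      exact/negligibleP.
    have PT : (0 < P setT)%E by rewrite probability_setT.
    exact: (@filter_ex _ _ (ae_properfilter_algebraOfSetsType PT) _ (filterI (filterI (cvgT u u0) (cvgT v v_ge0)) aeN)).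
  have := limit_direction (not_negative_weight w0) cu cv.
  by rewrite distrC ger0_norm ?subr_ge0.
apply: (@le_trans _ _ (0 + (A * expR (- (B * n%:R)))%:E)%E); last first.
  by rewrite add0e lee_fin mulrDl lerDl mulr_ge0// expR_ge0.
apply: (@le_trans _ _ (P (negative_weight W `|` [set om | (n%:R * (Lambda u + eps / 2) <=
      passage_time (W om) (0, 0) (n%:Z, Num.ceil (u * n%:R)))%R]))); last first.
  apply: probability_setU_le => //; first by rewrite neg0.
  exact: AB.
apply: le_measure; rewrite ?inE//; first exact: measurableU.
move=> om /= tail; have [neg|/not_negative_weight w0] := pselect (negative_weight W om).
  by left.
right; have := passage_time_direction n v u w0.
rewrite ger0_norm ?subr_ge0// => dist.
have n1 : 1 <= n%:R * eta.
  by apply: (le_trans n0e); rewrite ler_wpM2r ?(ltW eta0)// ler_nat.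
have E : eps = 6 * eta by rewrite /eta; lra.
have nn : 0 <= n%:R :> R by [].
rewrite E in tail *; nra.
Qed.
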